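(* Let $M$ be a hemi-slant submanifold of a cosymplectic manifold $N$, with $TM = D^{\theta}\oplus D^{\perp}\oplus\langle\xi\rangle$. Then the distribution $D^{\perp}$ is integrable if and only if $$A_{FZ}W = A_{FW}Z$$ for all $Z, W \in D^{\perp}$.
   Context: An almost contact metric manifold is a $(2m+1)$-dimensional manifold $N$ with structure $(\phi,\xi,\eta,g)$, where $\phi$ is a $(1,1)$-tensor field, $\xi$ a vector field, $\eta$ a one-form and $g$ a Riemannian metric, satisfying $\phi^2=-I+\eta\otimes\xi$, $\eta(\xi)=1$, $g(\phi X,\phi Y)=g(X,Y)-\eta(X)\eta(Y)$; consequently $\phi\xi=0$, $\eta(\phi X)=0$, $\eta(X)=g(X,\xi)$, $g(\phi X,Y)+g(X,\phi Y)=0$. A normal almost contact metric manifold $N$ with Levi-Civita connection $\overline{\nabla}$ is called cosymplectic if $\overline{\nabla}_X\phi=0$ and $\overline{\nabla}_X\xi=0$ for all $X$. $M$ is a submanifold of $N$ with $\xi$ tangent to $M$, equipped with the induced metric. Write $\overline{\nabla}_XY=\nabla_XY+h(X,Y)$ and $\overline{\nabla}_XV=-A_VX+\nabla^{\perp}_XV$ for $X,Y$ tangent to $M$ and $V$ normal to $M$ (Gauss and Weingarten formulae), where $\nabla$ is the induced connection, $h$ the second fundamental form, $A$ the shape operator and $\nabla^\perp$ the normal connection; $g(A_VX,Y)=g(h(X,Y),V)$. For $X$ tangent to $M$ write $\phi X=TX+FX$ with $TX$ tangent and $FX$ normal to $M$. $M$ is a hemi-slant submanifold if there are two orthogonal distributions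 $D^{\theta}$, $D^{\perp}$ on $M$ such that (i) $TM=D^{\theta}\oplus D^{\perp}\oplus\langle\xi\rangle$ (orthogonal sum), where $\langle\xi\rangle$ is the distribution spanned by $\xi$; (ii) $D^{\theta}$ is a slant distribution with slant angle $\theta\neq\frac{\pi}{2}$, i.e. for every $x\in M$ and every nonzero $X\in D^{\theta}_x$ the angle in $[0,\frac{\pi}{2}]$ between $\phi X$ and $T_xM$ equals the constant $\theta$; (iii) $D^{\perp}$ is totally real, i.e. $\phi D^{\perp}\subseteq T^{\perp}M$. *)

(* Defs.v *)
From HB Require Import structures.
From mathcomp Require Import all_boot all_order all_algebra.
From mathcomp Require Import all_classical all_reals all_analysis.

Set Implicit Arguments.
Unset Strict Implicit.
Unset Printing Implicit Defensive.

Import Order.TTheory GRing.Theory Num.Theory.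
Import numFieldNormedType.Exports.

Local Open Scope classical_set_scope.
Local Open Scope ring_scope.

(* [U] is meant to be open: C^(j+1) = differentiable with all directional
   derivatives of class C^j. *)
Fixpoint class_C (R : realType) (n : nat) (W : normedModType R) (j : nat)
    (U : set 'rV[R]_n) (h : 'rV[R]_n -> W) : Prop :=
  if j is j'.+1 then
    (forall u, U u -> differentiable h u) /\
    (forall v, class_C j' U (fun u => 'd h u v))
  else forall u, U u -> {for u, continuous h}.

Definition smooth_on (R : realType) (n : nat) (W : normedModType R)
    (U : set 'rV[R]_n) (h : 'rV[R]_n -> W) : Prop :=
  forall j, class_C j U h.

Definition smooth_near (R : realType) (n : nat) (W : normedModType R)
    (u : 'rV[R]_n) (h : 'rV[R]_n -> W) : Prop :=
  exists2 U : set 'rV[R]_n, open_nbhs u U & smooth_on U h.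

(* A smooth n-manifold, given by an atlas that is indexed by the points:
   [chart p] is a chart around [p] with domain [dom p] and inverse [param p].
   Every smooth structure contains such an atlas.  Values of [chart p] outside
   [dom p] and of [param p] outside the image of the chart are irrelevant. *)
Record manifold (R : realType) (n : nat) := Manifold {
  points :> topologicalType;
  dom : points -> set points;
  chart : points -> points -> 'rV[R]_n;
  param : points -> 'rV[R]_n -> points;
  manifold_hausdorff : hausdorff_space points;
  manifold_second_countable : @second_countable points;
  dom_open : forall p, open (dom p);
  mem_dom : forall p, dom p p;
  chart_image_open : forall p, open (chart p @` dom p);
  chartK : forall p q, dom p q -> param p (chart p q) = q;
  chart_continuous : forall p q, dom p q -> {for q, continuous (chart p)};
  param_continuous : forall p u,
    (chart p @` dom p) u -> {for u, continuous (param p)};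
  transition_smooth : forall p q,
    smooth_on (chart p @` (dom p `&` dom q)) (chart q \o param p)
}.

(* The tangent space T_pN is 'rV[R]_n: a tangent vector at [p] is represented
   by its components in the chart [chart p].  Its components in another chart
   are obtained by applying the differential of the transition map, see
   [local_rep].  A vector field on N is thus a function N -> 'rV[R]_n; a
   vector field along f : M -> N is a function M -> 'rV[R]_n whose value at x
   is read in T_(f x)N. *)

(* Real functions on M.  All smoothness notions "at x" mean: smooth on some
   neighbourhood of x. *)
Definition smooth_fun (R : realType) (k : nat) (M : manifold R k)
    (h : M -> R) (x : M) : Prop :=
  smooth_near (chart x x) (h \o param x : 'rV[R]_k -> R).

Definition deriv_fun (R : realType) (k : nat) (M : manifold R k)
    (h : M -> R) (x : M) (v : 'rV[R]_k) : R :=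
  'd (h \o param x : 'rV[R]_k -> R) (chart x x) v.

Definition smooth_map (R : realType) (k n : nat) (M : manifold R k)
    (N : manifold R n) (f : M -> N) : Prop :=
  continuous f /\
  forall x, smooth_near (chart x x) (chart (f x) \o f \o param x).

(* The differential df_x : T_xM -> T_(f x)N. *)
Definition push (R : realType) (k n : nat) (M : manifold R k)
    (N : manifold R n) (f : M -> N) (x : M) (v : 'rV[R]_k) : 'rV[R]_n :=
  'd (chart (f x) \o f \o param x) (chart x x) v.

Definition immersion (R : realType) (k n : nat) (M : manifold R k)
    (N : manifold R n) (f : M -> N) : Prop :=
  smooth_map f /\ forall x, injective (push f x).

(* Local representative, in the charts at [x] and at [f x], of a vector field
   [V] along [f]; a vector field on M is the case [f = id]. *)
Definition local_rep (R : realType) (k n : nat) (M : manifold R k)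
    (N : manifold R n) (f : M -> N) (V : M -> 'rV[R]_n) (x : M)
    (u : 'rV[R]_k) : 'rV[R]_n :=
  let y := param x u in
  'd (chart (f x) \o param (f y)) (chart (f y) (f y)) (V y).

Definition smooth_field (R : realType) (k : nat) (M : manifold R k)
    (X : M -> 'rV[R]_k) (x : M) : Prop :=
  smooth_near (chart x x) (local_rep id X x).

(* [X, Y]^j = X(Y^j) - Y(X^j) in the chart at x. *)
Definition lie_bracket (R : realType) (k : nat) (M : manifold R k)
    (X Y : M -> 'rV[R]_k) (x : M) : 'rV[R]_k :=
  'd (local_rep id Y x) (chart x x) (X x)
  - 'd (local_rep id X x) (chart x x) (Y x).

(* Metrics, endomorphism fields and one-forms are given by their matrices in
   the charts at the points; tangent vectors are row vectors. *)
Definition inner (R : realType) (n : nat) (N : manifold R n)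
    (g : N -> 'M[R]_n) (p : N) (u v : 'rV[R]_n) : R :=
  (u *m g p *m v^T) ord0 ord0.

Definition app_form (R : realType) (n : nat) (N : manifold R n)
    (eta : N -> 'cV[R]_n) (p : N) (u : 'rV[R]_n) : R :=
  (u *m eta p) ord0 ord0.

Definition app_endo (R : realType) (n : nat) (N : manifold R n)
    (phi : N -> 'M[R]_n) (p : N) (u : 'rV[R]_n) : 'rV[R]_n :=
  u *m phi p.

Definition riemannian_metric (R : realType) (n : nat) (N : manifold R n)
    (g : N -> 'M[R]_n) : Prop :=
  [/\ forall p u v, inner g p u v = inner g p v u,
      forall p u, u != 0 -> 0 < inner g p u u
    & forall p X Y, smooth_field X p -> smooth_field Y p ->
        smooth_fun (fun q => inner g q (X q) (Y q)) p].

(* An affine connection, as an operator on locally defined vector fields: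
   [nabla p v Y] is the derivative at p, in the direction v in T_pN, of a field
   Y that is smooth near p.  The Leibniz rule for functions smooth near p (such
   as indicators of neighbourhoods of p) makes it local in Y. *)
Definition affine_connection (R : realType) (n : nat) (N : manifold R n)
    (nabla : N -> 'rV[R]_n -> (N -> 'rV[R]_n) -> 'rV[R]_n) : Prop :=
  [/\ forall p (a : R) u v Y, smooth_field Y p ->
        nabla p (a *: u + v) Y = a *: nabla p u Y + nabla p v Y,
      forall p v X Y, smooth_field X p -> smooth_field Y p ->
        nabla p v (fun q => X q + Y q) = nabla p v X + nabla p v Y,
      forall p v (h : N -> R) Y, smooth_fun h p -> smooth_field Y p ->
        nabla p v (fun q => h q *: Y q)
        = deriv_fun h p v *: Y p + h p *: nabla p v Y
    & forall p X Y, smooth_field X p -> smooth_field Y p ->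
        smooth_field (fun q => nabla q (X q) Y) p].

Definition levi_civita (R : realType) (n : nat) (N : manifold R n)
    (g : N -> 'M[R]_n)
    (nabla : N -> 'rV[R]_n -> (N -> 'rV[R]_n) -> 'rV[R]_n) : Prop :=
  [/\ affine_connection nabla,
      forall p X Y, smooth_field X p -> smooth_field Y p ->
        nabla p (X p) Y - nabla p (Y p) X = lie_bracket X Y p
    & forall p v X Y, smooth_field X p -> smooth_field Y p ->
        deriv_fun (fun q => inner g q (X q) (Y q)) p v
        = inner g p (nabla p v X) (Y p) + inner g p (X p) (nabla p v Y)].

Definition almost_contact_metric (R : realType) (n : nat) (N : manifold R n)
    (phi : N -> 'M[R]_n) (xi : N -> 'rV[R]_n) (eta : N -> 'cV[R]_n)
    (g : N -> 'M[R]_n) : Prop :=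
  [/\ riemannian_metric g,
      [/\ forall p X, smooth_field X p ->
            smooth_field (fun q => app_endo phi q (X q)) p,
          forall p, smooth_field xi p
        & forall p X, smooth_field X p ->
            smooth_fun (fun q => app_form eta q (X q)) p],
      forall p u, app_endo phi p (app_endo phi p u)
                  = - u + app_form eta p u *: xi p,
      forall p, app_form eta p (xi p) = 1
    & forall p u v, inner g p (app_endo phi p u) (app_endo phi p v)
                    = inner g p u v - app_form eta p u * app_form eta p v].

Definition nijenhuis (R : realType) (n : nat) (N : manifold R n)
    (phi : N -> 'M[R]_n) (X Y : N -> 'rV[R]_n) (p : N) : 'rV[R]_n :=
  let phiX := fun q => app_endo phi q (X q) in
  let phiY := fun q => app_endo phi q (Y q) in
  app_endo phi p (app_endo phi p (lie_bracket X Y p)) + lie_bracket phiX phiY p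
  - app_endo phi p (lie_bracket phiX Y p)
  - app_endo phi p (lie_bracket X phiY p).

(* 2 d eta(X, Y), for the convention
   2 d eta(X, Y) = X(eta(Y)) - Y(eta(X)) - eta([X, Y]). *)
Definition twice_d (R : realType) (n : nat) (N : manifold R n)
    (eta : N -> 'cV[R]_n) (X Y : N -> 'rV[R]_n) (p : N) : R :=
  deriv_fun (fun q => app_form eta q (Y q)) p (X p)
  - deriv_fun (fun q => app_form eta q (X q)) p (Y p)
  - app_form eta p (lie_bracket X Y p).

(* [phi, phi] + 2 d eta (x) xi = 0 *)
Definition normal_structure (R : realType) (n : nat) (N : manifold R n)
    (phi : N -> 'M[R]_n) (xi : N -> 'rV[R]_n) (eta : N -> 'cV[R]_n) : Prop :=
  forall p X Y, smooth_field X p -> smooth_field Y p ->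
    nijenhuis phi X Y p + twice_d eta X Y p *: xi p = 0.

Definition cosymplectic (R : realType) (n : nat) (N : manifold R n)
    (phi : N -> 'M[R]_n) (xi : N -> 'rV[R]_n) (eta : N -> 'cV[R]_n)
    (g : N -> 'M[R]_n)
    (nabla : N -> 'rV[R]_n -> (N -> 'rV[R]_n) -> 'rV[R]_n) : Prop :=
  [/\ almost_contact_metric phi xi eta g,
      normal_structure phi xi eta,
      levi_civita g nabla,
      forall p v Y, smooth_field Y p ->
        nabla p v (fun q => app_endo phi q (Y q))
        - app_endo phi p (nabla p v Y) = 0
    & forall p v, nabla p v xi = 0].

(* The j-th coordinate vector field of the chart at p (meaningful on
   [dom p]). *)
Definition coord_field (R : realType) (n : nat) (N : manifold R n) (p : N)
    (j : 'I_n) (q : N) : 'rV[R]_n :=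
  'd (chart q \o param p) (chart p q) (delta_mx ord0 j).

(* The covariant derivative of a vector field V along f (the pull-back
   connection on f^*TN): if V = sum_j V^j (d_j o f) in the chart at f x, then
   nabla_v V = sum_j (v(V^j) d_j + V^j nabla_(df v) d_j).  For an immersion f
   and V = df(Y) this is the derivative at x of any local extension of df(Y)
   to N. *)
Definition cov_along (R : realType) (k n : nat) (M : manifold R k)
    (N : manifold R n) (f : M -> N)
    (nabla : N -> 'rV[R]_n -> (N -> 'rV[R]_n) -> 'rV[R]_n)
    (V : M -> 'rV[R]_n) (x : M) (v : 'rV[R]_k) : 'rV[R]_n :=
  'd (local_rep f V x) (chart x x) v
  + \sum_(j < n) V x ord0 j
      *: nabla (f x) (push f x v) (coord_field (f x) j).

(* Below, f : M -> N is the immersion of the submanifold M. *)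
Definition induced_inner (R : realType) (k n : nat) (M : manifold R k)
    (N : manifold R n) (g : N -> 'M[R]_n) (f : M -> N) (x : M)
    (u v : 'rV[R]_k) : R :=
  inner g (f x) (push f x u) (push f x v).

Definition is_normal (R : realType) (k n : nat) (M : manifold R k)
    (N : manifold R n) (g : N -> 'M[R]_n) (f : M -> N) (x : M)
    (w : 'rV[R]_n) : Prop :=
  forall u, inner g (f x) w (push f x u) = 0.

(* The tangential part, as a vector of T_xM, and the normal part of w in
   T_(f x)N. *)
Definition tan_part (R : realType) (k n : nat) (M : manifold R k)
    (N : manifold R n) (g : N -> 'M[R]_n) (f : M -> N) (x : M)
    (w : 'rV[R]_n) : 'rV[R]_k :=
  xget 0 [set u | is_normal g f x (w - push f x u)].

Definition nor_part (R : realType) (k n : nat) (M : manifold R k)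
    (N : manifold R n) (g : N -> 'M[R]_n) (f : M -> N) (x : M)
    (w : 'rV[R]_n) : 'rV[R]_n :=
  w - push f x (tan_part g f x w).

(* phi X = TX + FX *)
Definition F_part (R : realType) (k n : nat) (M : manifold R k)
    (N : manifold R n) (phi g : N -> 'M[R]_n) (f : M -> N) (x : M)
    (u : 'rV[R]_k) : 'rV[R]_n :=
  nor_part g f x (app_endo phi (f x) (push f x u)).

(* A_V v at x for a normal field V: minus the tangential part of the ambient
   derivative of V (Weingarten formula). *)
Definition shape_operator (R : realType) (k n : nat) (M : manifold R k)
    (N : manifold R n) (g : N -> 'M[R]_n)
    (nabla : N -> 'rV[R]_n -> (N -> 'rV[R]_n) -> 'rV[R]_n) (f : M -> N)
    (V : M -> 'rV[R]_n) (x : M) (v : 'rV[R]_k) : 'rV[R]_k :=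
  - tan_part g f x (cov_along f nabla V x v).

(* The angle between w and T_xM is the angle between w and its orthogonal
   projection onto T_xM. *)
Definition angle_with_tangent (R : realType) (k n : nat) (M : manifold R k)
    (N : manifold R n) (g : N -> 'M[R]_n) (f : M -> N) (x : M)
    (w : 'rV[R]_n) : R :=
  let u := tan_part g f x w in
  acos (Num.sqrt (induced_inner g f x u u) / Num.sqrt (inner g (f x) w w)).

Definition distribution (R : realType) (k : nat) (M : manifold R k)
    (D : M -> {vspace 'rV[R]_k}) : Prop :=
  exists d : nat, forall x, exists E : 'I_d -> M -> 'rV[R]_k,
    (forall j, smooth_field (E j) x) /\
    \forall y \near x,
      \dim (D y) = d /\ D y = <<[seq E j y | j <- enum 'I_d]>>%VS.

(* Z is a smooth section of D on a neighbourhood of x. *)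
Definition section_at (R : realType) (k : nat) (M : manifold R k)
    (D : M -> {vspace 'rV[R]_k}) (Z : M -> 'rV[R]_k) (x : M) : Prop :=
  smooth_field Z x /\ \forall y \near x, Z y \in D y.

(* Integrability of a distribution: closure under the Lie bracket of (local)
   sections. *)
Definition integrable_distribution (R : realType) (k : nat) (M : manifold R k)
    (D : M -> {vspace 'rV[R]_k}) : Prop :=
  forall x Z W, section_at D Z x -> section_at D W x ->
    lie_bracket Z W x \in D x.

Definition hemi_slant (R : realType) (k n : nat) (M : manifold R k)
    (N : manifold R n) (phi : N -> 'M[R]_n) (xi : N -> 'rV[R]_n)
    (g : N -> 'M[R]_n) (f : M -> N) (theta : R)
    (Dslant Dperp : M -> {vspace 'rV[R]_k}) : Prop :=
  let xiM := fun x => tan_part g f x (xi (f x)) in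
  [/\ forall x, push f x (xiM x) = xi (f x),
      distribution Dslant /\ distribution Dperp,
      forall x,
        [/\ forall u v, u \in Dslant x -> v \in Dperp x ->
              induced_inner g f x u v = 0,
            forall u, u \in Dslant x -> induced_inner g f x u (xiM x) = 0,
            forall v, v \in Dperp x -> induced_inner g f x v (xiM x) = 0
          & (Dslant x + Dperp x + <[xiM x]>)%VS = fullv],
      [/\ 0 <= theta <= pi / 2, theta != pi / 2
        & forall x u, u \in Dslant x -> u != 0 ->
            angle_with_tangent g f x (app_endo phi (f x) (push f x u)) = theta]
    & forall x v, v \in Dperp x ->
        is_normal g f x (app_endo phi (f x) (push f x v))].

(* Main.v *)
From HB Require Import structures.
Require Import Defs.
From mathcomp Require Import all_boot all_order all_algebra.
From mathcomp Require Import all_classical all_reals all_analysis.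
From mathcomp Require Import ring lra.
Set Implicit Arguments.
Unset Strict Implicit.
Unset Printing Implicit Defensive.
Import Order.TTheory GRing.Theory Num.Theory.
Import numFieldNormedType.Exports.
Local Open Scope classical_set_scope.
Local Open Scope ring_scope.

(* Differentiating along f with the pulled-back connection, which is torsion
   free and for which phi is parallel, one gets for sections Z, W of D^perp,
   where FZ = phi (f_* Z) and TZ = 0,
     A_FZ W - A_FW Z = tan (phi (nabla_Z W - nabla_W Z)) = T [Z, W].
   As phi maps D^perp to normal vectors and kills xi, T only sees the D^theta
   component of [Z, W], on which it is injective because theta <> pi/2.
   The xi component of [Z, W] always vanishes: eta (f_* Z) = 0 gives
   phi^2 (f_* Z) = - f_* Z along M, and differentiating this relation shows
   eta (nabla_v (f_* Z)) = 0.

   In charts, parallelism of phi reduces to the expansion of the connection in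
   a coordinate frame, and torsion-freeness to the symmetry of the Christoffel
   symbols and of the second derivatives of the local expression of f. *)

(** * Differentials and symmetry of second derivatives *)

(** The first-order expansion at [x] only involves values near [x], so it passes from [f] to [g]
    with the same linear part, which uniqueness identifies with ['d g x]. *)
Lemma near_eq_is_diff (R : realType) (V W : normedModType R) (f g : V -> W)
    (df : V -> W) (x : V) :
  (\forall y \near x, f y = g y) -> is_diff x f df -> is_diff x g df.
Proof.
move=> fg fdf.
have dfx : differentiable f x by exact: ex_diff.
have <- : 'd f x = df :> (V -> W) by exact: diff_val.
have g_loc : g \o shift x = cst (g x) + 'd f x +o_ 0 id.
  apply/eqaddoP => _/posnumP[e].
  have /eqaddoP/(_ e%:num (gt0 e)) := diff_locally dfx.
  have fg0 : \forall h \near 0, f (h + x) = g (h + x).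
    by move: fg; rewrite (near_shift 0); apply: filterS => h; rewrite /= subr0.
  apply: filterS2 fg0 => h /= fgh; rewrite !fctE /= fgh.
  by rewrite (nbhs_singleton fg).
have dg : 'd g x = 'd f x :> (V -> W).
  by apply: diff_unique => //; exact: diff_continuous.
apply: DiffDef => //.
by apply/diff_locallyP; rewrite dg; split => //; exact: diff_continuous.
Qed.

Lemma near_eq_diff (R : realType) (V W : normedModType R) (f g : V -> W)
    (x : V) :
  (\forall y \near x, f y = g y) -> differentiable f x ->
  'd g x = 'd f x :> (V -> W).
Proof.
by move=> fg /differentiableP df; have [] := near_eq_is_diff fg df.
Qed.

Lemma near_eq_differentiable (R : realType) (V W : normedModType R)
    (f g : V -> W) (x : V) :
  (\forall y \near x, f y = g y) -> differentiable f x -> differentiable g x.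
Proof.
by move=> fg /differentiableP df; have [] := near_eq_is_diff fg df.
Qed.

(** Scaling is a continuous bilinear map, so this product rule is the chain rule through the pair
    [(f, g)]. *)
Lemma is_diff_scale (R : realType) (V W : normedModType R) (f df : V -> R)
    (g dg : V -> W) (x : V) :
  is_diff x f df -> is_diff x g dg ->
  is_diff x (fun y => f y *: g y) (fun v => f x *: dg v + df v *: g x).
Proof.
move=> fdf gdg.
have bil : bilinear_for (GRing.Scale.Law.clone _ _ *:%R _)
    (GRing.Scale.Law.clone _ _ *:%R _) (@GRing.scale R W).
  by split=> [w|a] c u v /=; rewrite ?scalerDl ?scalerA// scalerDr !scalerA mulrC.
pose b0 := bilinear_isBilinear.Build R R W W _ _ (@GRing.scale R W) bil.
pose b : {bilinear R -> W -> W} := HB.pack (@GRing.scale R W) b0.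
have bc : continuous (fun p => b p.1 p.2) by move=> p; exact: scale_continuous.
have db p : is_diff p (fun q : R * W => q.1 *: q.2)
    (fun q => p.1 *: q.2 + q.1 *: p.2).
  by apply: DiffDef;
    [exact: (differentiable_bilin p bc)|exact: (diff_bilin p bc)].
exact: (@is_diff_comp _ _ _ _ (fun y => (f y, g y)) _
  (fun q : R * W => q.1 *: q.2) _ x (is_diff_pair fdf gdg) (db (f x, g x))).
Qed.

Lemma is_diff_sum (R : realType) (V W : normedModType R) (n : nat)
    (f df : 'I_n -> V -> W) (x : V) :
  (forall i, is_diff x (f i) (df i)) ->
  is_diff x (fun y => \sum_i f i y) (fun v => \sum_i df i v).
Proof.
move=> fdf.
have -> : (fun y => \sum_i f i y) = \sum_i f i.
  by apply/funext => y; rewrite fct_sumE.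
have -> : (fun y => \sum_i df i y) = \sum_i df i.
  by apply/funext => y; rewrite fct_sumE.
elim/big_ind2 : _ => [|g1 g2 h1 h2|i _].
- exact: is_diff_cst.
- exact: is_diffD.
- exact: fdf.
Qed.

Lemma is_diff_coord (R : realType) (V : normedModType R) (n : nat)
    (f df : V -> 'rV[R]_n) (x : V) (j : 'I_n) :
  is_diff x f df ->
  is_diff x (fun y => f y ord0 j : R) (fun v => df v ord0 j : R).
Proof.
move=> fdf.
have dc (u : 'rV[R]_n) : is_diff u (fun w : 'rV[R]_n => w ord0 j : R)
    (fun w : 'rV[R]_n => w ord0 j : R).
  have @l : {linear 'rV[R]_n -> R}.
    by exists (fun w : 'rV[R]_n => w ord0 j); do 2![eexists]; do ?[constructor];
     rewrite ?mxE// => ? *; rewrite ?mxE//; move=> ?; rewrite !mxE.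
  have lc : continuous l by exact: coord_continuous.
  apply: DiffDef; first exact: (linear_differentiable (f := l)).
  exact: (diff_lin (f := l)).
exact: is_diff_comp.
Qed.

Lemma linear_row (R : realType) (k : nat) (W : lmodType R)
    (L : {linear 'rV[R]_k -> W}) (v : 'rV[R]_k) :
  L v = \sum_j v ord0 j *: L (delta_mx ord0 j).
Proof.
rewrite {1}[v]row_sum_delta linear_sum.
by apply: eq_bigr => j _; rewrite linearZ.
Qed.

(** The mean value theorem along [a] turns the second difference into [s] times an increment of
    [y |-> 'd f y a] in the direction [s *: b]; the first-order expansion of that map at [u] then
    gives the estimate. *)
Lemma second_difference (R : realType) (V : normedModType R) (f : V -> R)
    (u a b : V) (e : R) :
  (\forall y \near u, differentiable f y) ->
  differentiable (fun y => 'd f y a : R) u -> 0 < e ->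
  \forall s \near 0^'+,
    `|f (u + s *: a + s *: b) - f (u + s *: a) - f (u + s *: b) + f u
      - s ^+ 2 * 'd (fun y => 'd f y a : R) u b| <= e * s ^+ 2.
Proof.
move=> f_diff A_diff e0.
set A := fun y => 'd f y a : R.
(* The two expansion errors are at most [e / c] times [s * (|a| + |b|)] and [s * |a|], so [c] must
   dominate [2 * |a| + |b|]; the added 1 keeps it positive. *)
pose c := 2 * `|a| + `|b| + 1.
have c0 : 0 < c by rewrite ltr_wpDl ?addr_ge0 ?mulr_ge0.
have ec0 : 0 < e / c by rewrite divr_gt0.
have A_loc : \forall h \near 0, `|A (h + u) - A u - 'd A u h| <= e / c * `|h|.
  have /eqaddoP/(_ _ ec0) := diff_locally A_diff.
  by apply: filterS => h; rewrite !fctE /= opprD addrA.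
have f_loc : \forall h \near (0 : V), differentiable f (h + u).
  by move: f_diff; rewrite (near_shift 0); apply: filterS => h; rewrite /= subr0.
have /nbhs_norm0P[r /= r0 hr] : \forall h \near (0 : V),
    `|A (h + u) - A u - 'd A u h| <= e / c * `|h| /\ differentiable f (h + u).
  by apply: filterS2 A_loc f_loc.
near=> s.
have s0 : 0 < s by [].
have sr : s * c < r.
  rewrite -ltr_pdivlMr//; near: s; apply: nbhs_right_lt; exact: divr_gt0.
have small (t w : R) : 0 <= t <= s -> 0 <= w <= s ->
    `|t *: a + w *: b| <= s * (`|a| + `|b|).
  move=> /andP[t0 ts] /andP[w0 ws].
  rewrite (le_trans (ler_normD _ _))// !normrZ !ger0_norm// mulrDr.
  by rewrite lerD// ler_wpM2r.
have smallr (t w : R) : 0 <= t <= s -> 0 <= w <= s -> `|t *: a + w *: b| < r.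
  move=> ht hw; apply: le_lt_trans (small _ _ ht hw) _; apply: le_lt_trans sr.
  by rewrite ler_pM2l// /c; have := normr_ge0 a; lra.
have f_der (t w : R) : 0 <= t <= s -> 0 <= w <= s ->
    is_derive t 1 (fun t : R => f (u + t *: a + w *: b)) (A (u + t *: a + w *: b)).
  move=> ht hw.
  have fd : differentiable f (u + t *: a + w *: b).
    by rewrite -addrA addrC; apply: (hr _ _).2; rewrite /= smallr.
  have ld : is_diff t (fun t => u + t *: a + w *: b) ( *:%R^~ a).
    have := is_diffD (is_diffD (is_diff_cst u t) (is_diff_scalel t a))
      (is_diff_cst (w *: b) t).
    by move=> /is_diff_eq; apply; apply/funext => z; rewrite !fctE /= add0r addr0.
  have := is_diff_comp ld (differentiableP fd) => -[d1 d2].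
  have /derivableP : derivable (fun t : R => f (u + t *: a + w *: b)) t 1.
    exact: diff_derivable.
  by rewrite deriveE// d2 /= scale1r.
pose p (t : R) := f (u + t *: a + s *: b) - f (u + t *: a).
have ss : 0 <= s <= s by rewrite lexx ltW.
have zs : 0 <= (0 : R) <= s by rewrite lexx ltW.
have p_der (t : R) : 0 <= t <= s ->
    is_derive t 1 p (A (u + t *: a + s *: b) - A (u + t *: a)).
  move=> ht; apply: is_deriveB; first exact: f_der.
  have := f_der t 0 ht zs.
  under eq_fun do rewrite scale0r addr0.
  by rewrite scale0r addr0.
have [t t_in pE] : exists2 t, t \in `]0, s[ &
    p s - p 0 = (A (u + t *: a + s *: b) - A (u + t *: a)) * (s - 0).
  apply: MVT => // [t /itvP ht|]; first by apply: p_der; rewrite !ht.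
  apply: derivable_within_continuous => t; rewrite in_itv /= => ht.
  by apply: ex_derive; exact: p_der.
have ht : 0 <= t <= s by rewrite !(itvP t_in).
have -> : f (u + s *: a + s *: b) - f (u + s *: a) - f (u + s *: b) + f u
    = p s - p 0 by rewrite /p scale0r addr0; ring.
rewrite {}pE subr0 expr2.
have H1 := (hr _ (smallr _ _ ht ss)).1.
have H2 := (hr _ (smallr _ _ ht zs)).1.
have dE : 'd A u (t *: a + s *: b) = t * 'd A u a + s * 'd A u b.
  by rewrite linearD !linearZ.
have dE0 : 'd A u (t *: a) = t * 'd A u a by rewrite linearZ.
move: H1 H2; rewrite !scale0r !addr0 dE dE0 ![_ + u]addrC !addrA.
set x1 := A _; set x2 := A u; set x3 := A (u + t *: a); set y1 := 'd A u a.
set y2 := 'd A u b => H1 H2.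
(* The contributions [t * y1] of the direction [a] cancel between the expansions at the two points,
   both taken at [u]. *)
have -> : (x1 - x3) * s - s * s * y2 =
    s * ((x1 - x2 - (t * y1 + s * y2)) - (x3 - x2 - t * y1)).
  by ring.
rewrite normrM gtr0_norm//.
have -> : e * (s * s) = s * (e * s) by ring.
rewrite ler_pM2l// (le_trans (ler_normB _ _))//.
apply: le_trans (lerD H1 H2) _.
have := small t s ht ss; have := small t 0 ht zs; rewrite scale0r addr0 => h2 h1.
rewrite -mulrDr -mulrA ler_pM2l// mulrC ler_pdivrMr//.
have h2' : `|t *: a| <= s * `|a|.
  by rewrite normrZ; case/andP: ht => ? ?; rewrite ger0_norm// ler_wpM2r.
by rewrite /c; nra.
Unshelve. all: by end_near.
Qed.

(* Both mixed derivatives are the limit of the symmetric second difference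
   divided by s^2. *)
Lemma diff_sym_real (R : realType) (V : normedModType R) (f : V -> R)
    (u a b : V) :
  (\forall y \near u, differentiable f y) ->
  differentiable (fun y => 'd f y a : R) u ->
  differentiable (fun y => 'd f y b : R) u ->
  'd (fun y => 'd f y a : R) u b = 'd (fun y => 'd f y b : R) u a.
Proof.
move=> f_diff A_diff B_diff.
apply/eqP; rewrite -subr_eq0 -normr_le0; apply/ler_addgt0Pr => e e0.
have e2 : 0 < e / 2 by rewrite divr_gt0.
have H1 := second_difference b f_diff A_diff e2.
have H2 := second_difference a f_diff B_diff e2.
have [s [s0 [h1 h2]]] : exists s : R, 0 < s /\ 
   (`|f (u + s *: a + s *: b) - f (u + s *: a) - f (u + s *: b) + f u
      - s ^+ 2 * 'd (fun y => 'd f y a : R) u b| <= e / 2 * s ^+ 2 /\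
    `|f (u + s *: b + s *: a) - f (u + s *: b) - f (u + s *: a) + f u
      - s ^+ 2 * 'd (fun y => 'd f y b : R) u a| <= e / 2 * s ^+ 2).
  apply: (@filter_ex _ (0^'+ : set_system R)).
  by near=> s; split=> //; split; near: s.
move: h1 h2; rewrite (addrAC u (s *: b)).
set X := f (_ + _ + _); set dA := 'd _ u b; set dB := 'd _ u a => h1 h2.
have s2 : 0 < s ^+ 2 by rewrite exprn_gt0.
rewrite add0r -(ler_pM2l s2) -[X in X * `|_|]gtr0_norm// -normrM.
have -> : s ^+ 2 * (dA - dB) =
  (X - f (u + s *: b) - f (u + s *: a) + f u - s ^+ 2 * dB) -
  (X - f (u + s *: a) - f (u + s *: b) + f u - s ^+ 2 * dA) by ring.
rewrite (le_trans (ler_normB _ _))// (le_trans (lerD h2 h1))//.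
by rewrite -mulrDl -splitr mulrC.
Unshelve. all: by end_near.
Qed.

Lemma diff_sym (R : realType) (V : normedModType R) (n : nat)
    (f : V -> 'rV[R]_n) (u a b : V) :
  (\forall y \near u, differentiable f y) ->
  differentiable (fun y => 'd f y a) u ->
  differentiable (fun y => 'd f y b) u ->
  'd (fun y => 'd f y a) u b = 'd (fun y => 'd f y b) u a.
Proof.
move=> f_diff A_diff B_diff; apply/rowP => j.
have dj (g : V -> 'rV[R]_n) y : differentiable g y ->
    is_diff y (fun y => g y ord0 j : R) (fun v => 'd g y v ord0 j : R).
  by move=> /differentiableP/is_diff_coord; apply.
have djE (v : V) : \forall y \near u,
    'd f y v ord0 j = 'd (fun y => f y ord0 j : R) y v :> R.
  by apply: filterS f_diff => y /dj [_ ->].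
have fj : \forall y \near u, differentiable (fun y => f y ord0 j : R) y.
  by apply: filterS f_diff => y /dj [].
have [A1 A2] := near_eq_is_diff (djE a) (dj _ _ A_diff).
have [B1 B2] := near_eq_is_diff (djE b) (dj _ _ B_diff).
have := diff_sym_real fj A1 B1.
by rewrite A2 B2.
Qed.

(** * Smooth maps *)

Section ClassC.
Variables (R : realType) (n : nat).
Implicit Types (U : set 'rV[R]_n) (W : normedModType R).

Lemma sub_class_C W j U U' (h : 'rV[R]_n -> W) :
  U' `<=` U -> class_C j U h -> class_C j U' h.
Proof.
move=> U'U; elim: j h => [|j IH] h /=; first by move=> hC u /U'U; exact: hC.
by move=> [hd hC]; split=> [u /U'U|v]; [exact: hd|exact: IH].
Qed.

(** As [U] is open, equality on [U] is equality near each of its points, which determines limits and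
    differentials. *)
Lemma eq_class_C W j U (h h' : 'rV[R]_n -> W) :
  open U -> (forall u, U u -> h u = h' u) -> class_C j U h -> class_C j U h'.
Proof.
move=> Uo hh'.
have near_eq (g g' : 'rV[R]_n -> W) : (forall u, U u -> g u = g' u) ->
    forall u, U u -> \forall y \near u, g y = g' y.
  by move=> gg' u Uu; apply: filterS gg' _; exact: open_nbhs_nbhs.
elim: j h h' hh' => [|j IH] h h' hh' /=; have near_hh' := near_eq _ _ hh'.
  move=> hC u Uu; change (h' @ u --> h' u); rewrite -(hh' _ Uu).
  by apply: cvg_trans (hC u Uu); exact: (near_eq_cvg (near_hh' u Uu)).
move=> [hd hC]; split=> [u Uu|v].
  exact: near_eq_differentiable (near_hh' u Uu) (hd u Uu).
apply: IH (hC v) => u Uu; rewrite -(near_eq_diff (near_hh' u Uu))//.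
exact: hd.
Qed.

Lemma class_C_pred W j U (h : 'rV[R]_n -> W) :
  class_C j.+1 U h -> class_C j U h.
Proof.
elim: j h => [|j IH] h [hd hC].
  by move=> u Uu; apply: differentiable_continuous; exact: hd.
by split=> // v; exact: IH.
Qed.

Lemma class_C_cst W j U (w : W) : class_C j U (fun _ => w).
Proof.
elim: j w => [|j IH] w /=; first by move=> u _; exact: cst_continuous.
split=> [u _|v]; first exact: differentiable_cst.
rewrite (_ : (fun _ => _) = fun _ => 0); first exact: IH.
by apply/funext => u; rewrite (diff_cst w u).
Qed.

Lemma class_CD W j U (h1 h2 : 'rV[R]_n -> W) : open U ->
  class_C j U h1 -> class_C j U h2 -> class_C j U (fun u => h1 u + h2 u).
Proof.
move=> Uo; elim: j h1 h2 => [|j IH] h1 h2 /=.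
  by move=> C1 C2 u Uu; apply: continuousD; [exact: C1|exact: C2].
move=> [d1 C1] [d2 C2]; split=> [u Uu|v].
  by apply: differentiableD; [exact: d1|exact: d2].
apply: eq_class_C (IH _ _ (C1 v) (C2 v)) => // u Uu.
by rewrite (diffD (d1 u Uu) (d2 u Uu)).
Qed.

(** In the product rule each term pairs a derivative of class C^j with an undifferentiated factor of
    class C^(j+1), which is first lowered to class C^j. *)
Lemma class_CZ W j U (h : 'rV[R]_n -> R) (g : 'rV[R]_n -> W) : open U ->
  class_C j U h -> class_C j U g -> class_C j U (fun u => h u *: g u).
Proof.
move=> Uo; elim: j h g => [|j IH] h g.
  by move=> Ch Cg u Uu; apply: continuousZ; [exact: Ch|exact: Cg].
move=> Ch Cg; have [dh Ch'] := Ch; have [dg Cg'] := Cg.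
have d u (Uu : U u) := is_diff_scale (differentiableP (dh u Uu))
  (differentiableP (dg u Uu)).
split=> [u Uu|v]; first by have [] := d u Uu.
have C := class_CD Uo (IH _ _ (class_C_pred Ch) (Cg' v))
  (IH _ _ (Ch' v) (class_C_pred Cg)).
by apply: eq_class_C C => // u Uu; have [_ ->] := d u Uu.
Qed.

Lemma class_C_coord m j U (h : 'rV[R]_n -> 'rV[R]_m) i : open U ->
  class_C j U h -> class_C j U (fun u => h u ord0 i : R).
Proof.
move=> Uo; elim: j h => [|j IH] h.
  move=> Ch u Uu; apply: (@continuous_comp _ _ _ h (fun w => w ord0 i : R)).
    exact: Ch.
  exact: coord_continuous.
move=> [dh Ch].
have d u (Uu : U u) := is_diff_coord i (differentiableP (dh u Uu)).
split=> [u Uu|v]; first by have [] := d u Uu.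
by apply: eq_class_C (IH _ (Ch v)) => // u Uu; have [_ ->] := d u Uu.
Qed.

End ClassC.

Section SmoothNear.
Variables (R : realType) (n : nat).
Implicit Types (u : 'rV[R]_n) (W : normedModType R).

Lemma eq_smooth_near W u (h h' : 'rV[R]_n -> W) :
  (\forall y \near u, h y = h' y) -> smooth_near u h -> smooth_near u h'.
Proof.
rewrite /prop_near1 nbhsE => -[U1 [U1o U1u] hh'] [U2 [U2o U2u] hC].
exists (U1 `&` U2); first by split; [exact: openI|].
move=> j; apply: (@eq_class_C _ _ _ _ _ h); first exact: openI.
  by move=> y [/hh'].
by apply: sub_class_C (hC j); exact: subIsetr.
Qed.

Lemma smooth_near_cst W u (w : W) : smooth_near u (fun _ => w).
Proof. by exists setT; [split; [exact: openT|]|move=> j; exact: class_C_cst]. Qed.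

Lemma smooth_nearD W u (h1 h2 : 'rV[R]_n -> W) :
  smooth_near u h1 -> smooth_near u h2 -> smooth_near u (fun v => h1 v + h2 v).
Proof.
move=> [U1 [U1o U1u] C1] [U2 [U2o U2u] C2].
exists (U1 `&` U2); first by split; [exact: openI|].
move=> j; apply: class_CD; first exact: openI.
  by apply: sub_class_C (C1 j); exact: subIsetl.
by apply: sub_class_C (C2 j); exact: subIsetr.
Qed.

Lemma smooth_nearZ W u (h : 'rV[R]_n -> R) (g : 'rV[R]_n -> W) :
  smooth_near u h -> smooth_near u g -> smooth_near u (fun v => h v *: g v).
Proof.
move=> [U1 [U1o U1u] C1] [U2 [U2o U2u] C2].
exists (U1 `&` U2); first by split; [exact: openI|].
move=> j; apply: class_CZ; first exact: openI.
  by apply: sub_class_C (C1 j); exact: subIsetl.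
by apply: sub_class_C (C2 j); exact: subIsetr.
Qed.

Lemma smooth_near_coord m u (h : 'rV[R]_n -> 'rV[R]_m) i :
  smooth_near u h -> smooth_near u (fun v => h v ord0 i : R).
Proof.
by move=> [U [Uo Uu] C]; exists U => // j; apply: class_C_coord.
Qed.

Lemma smooth_near_differentiable W u (h : 'rV[R]_n -> W) :
  smooth_near u h -> \forall y \near u, differentiable h y.
Proof.
move=> [U Uu C]; apply: filterS (open_nbhs_nbhs Uu) => y.
by have [+ _] := C 1; apply.
Qed.

Lemma smooth_near_diff W u (h : 'rV[R]_n -> W) v :
  smooth_near u h -> smooth_near u (fun y => 'd h y v).
Proof. by move=> [U Uu C]; exists U => // j; have [_] := C j.+1; apply. Qed.

Lemma smooth_near_diff_sym m u (h : 'rV[R]_n -> 'rV[R]_m) a b :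
  smooth_near u h ->
  'd (fun y => 'd h y a) u b = 'd (fun y => 'd h y b) u a.
Proof.
move=> hC; apply: diff_sym; first exact: smooth_near_differentiable.
  exact: nbhs_singleton (smooth_near_differentiable (smooth_near_diff a hC)).
exact: nbhs_singleton (smooth_near_differentiable (smooth_near_diff b hC)).
Qed.

End SmoothNear.

(** * Charts, fields and connections *)

Section Charts.
Variables (R : realType) (n : nat) (N : manifold R n).
Implicit Types (p q r : N) (u v : 'rV[R]_n).

Lemma paramK p u : (chart p @` dom p) u -> chart p (param p u) = u.
Proof. by move=> [q pq <-]; rewrite chartK. Qed.

Lemma near_chart_image p q :
  dom p q -> \forall u \near chart p q, (chart p @` dom p) u.
Proof.
move=> pq; apply: open_nbhs_nbhs; split; first exact: chart_image_open.
by exists q.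
Qed.

Lemma near_param p q (P : N -> Prop) :
  dom p q -> (\forall r \near q, P r) -> \forall u \near chart p q, P (param p u).
Proof.
move=> pq; rewrite -{1}(chartK pq); apply: param_continuous.
by exists q.
Qed.

Lemma near_dom p q : dom p q -> \forall r \near q, dom p r.
Proof. by move=> pq; apply: open_nbhs_nbhs; split; first exact: dom_open. Qed.

Lemma transition_differentiable p q r : dom p r -> dom q r ->
  differentiable (chart q \o param p) (chart p r).
Proof.
move=> pr qr; have [+ _] := transition_smooth p q 1; apply.
by exists r.
Qed.

(** [param p] inverts the chart only on its image, but this image is open, so the composite is the
    identity near [chart p q]. *)
Lemma diff_chart_id p q : dom p q ->
  is_diff (chart p q) (chart p \o param p) id.
Proof.
move=> pq; apply: near_eq_is_diff (is_diff_id (chart p q)).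
by apply: filterS (near_chart_image pq) => u /paramK.
Qed.

(** Chain rule for [h \o param q], which near [chart q r] factors as [h \o param p] after the
    transition map. *)
Lemma diff_param_change (W : normedModType R) (h : N -> W) p q r :
  dom p r -> dom q r -> differentiable (h \o param p) (chart p r) ->
  is_diff (chart q r) (h \o param q)
    ('d (h \o param p) (chart p r) \o 'd (chart p \o param q) (chart q r)).
Proof.
move=> pr qr dh.
have dpq := transition_differentiable qr pr.
have e : chart p r = (chart p \o param q) (chart q r) by rewrite /= chartK.
have dh' : is_diff ((chart p \o param q) (chart q r)) (h \o param p)
    ('d (h \o param p) (chart p r)).
  by rewrite -e; exact: differentiableP.
apply: near_eq_is_diff (is_diff_comp (differentiableP dpq) dh').
apply: filterS (near_param qr (near_dom pr)) => u pu.
by rewrite /= chartK.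
Qed.

(** The change of parametrization applied to the transition map itself: going from chart [q] to [p]
    and back is [chart q \o param q]. *)
Lemma diff_transitionK p q v : dom p q ->
  'd (chart q \o param p) (chart p q) ('d (chart p \o param q) (chart q q) v)
  = v.
Proof.
move=> pq; have qq := mem_dom q.
have [_ H] := diff_param_change pq qq (transition_differentiable pq qq).
have [_ H'] := diff_chart_id qq.
exact: esym (congr1 (fun F => F v) (etrans (esym H') H)).
Qed.

Lemma diff_transitionVK p q v : dom p q ->
  'd (chart p \o param q) (chart q q) ('d (chart q \o param p) (chart p q) v)
  = v.
Proof.
move=> pq; have qq := mem_dom q.
have [_ H] := diff_param_change qq pq (transition_differentiable qq pq).
have [_ H'] := diff_chart_id pq.
exact: esym (congr1 (fun F => F v) (etrans (esym H') H)).
Qed.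

Lemma coord_field_expansion p q v : dom p q ->
  v = \sum_j ('d (chart p \o param q) (chart q q) v) ord0 j
        *: coord_field p j q.
Proof. by move=> pq; rewrite -{1}(diff_transitionK v pq) [LHS]linear_row. Qed.

Lemma coord_field_base p j : coord_field p j p = delta_mx ord0 j.
Proof. by rewrite /coord_field; have [_ ->] := diff_chart_id (mem_dom p). Qed.

Lemma near_local_rep_coord p j :
  \forall u \near chart p p,
    local_rep (M := N) id (coord_field p j) p u = delta_mx ord0 j.
Proof.
apply: filterS (near_chart_image (mem_dom p)) => u [q pq <-].
by rewrite /local_rep chartK// diff_transitionVK.
Qed.

Lemma smooth_field_coord p j : smooth_field (coord_field p j) p.
Proof.
apply: eq_smooth_near (smooth_near_cst _ (delta_mx ord0 j)).
by apply: filterS (near_local_rep_coord p j) => u ->.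
Qed.

Lemma eq_smooth_field (X Y : N -> 'rV[R]_n) p :
  (\forall q \near p, X q = Y q) -> smooth_field X p -> smooth_field Y p.
Proof.
move=> XY; apply: eq_smooth_near.
apply: filterS (near_param (mem_dom p) XY) => u XYu.
by rewrite /local_rep XYu.
Qed.

Lemma smooth_field0 p : smooth_field (fun _ : N => 0) p.
Proof.
rewrite /smooth_field (_ : local_rep _ _ _ = fun _ => 0).
  exact: smooth_near_cst.
by apply/funext => u; rewrite /local_rep linear0.
Qed.

Lemma smooth_fieldD (X Y : N -> 'rV[R]_n) p :
  smooth_field X p -> smooth_field Y p -> smooth_field (fun q => X q + Y q) p.
Proof.
move=> X_sm Y_sm; rewrite /smooth_field.
rewrite (_ : local_rep _ _ _ = fun u => local_rep id X p u + local_rep id Y p u).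
  exact: smooth_nearD.
by apply/funext => u; rewrite /local_rep linearD.
Qed.

Lemma smooth_fieldZ (h : N -> R) (Y : N -> 'rV[R]_n) p :
  smooth_fun h p -> smooth_field Y p -> smooth_field (fun q => h q *: Y q) p.
Proof.
move=> h_sm Y_sm; rewrite /smooth_field.
rewrite (_ : local_rep _ _ _ = fun u => h (param p u) *: local_rep id Y p u).
  exact: smooth_nearZ.
by apply/funext => u; rewrite /local_rep linearZ.
Qed.

(** The Leibniz rule concerns functions on the manifold, so the components of a local representative
    are pulled back by [chart p]; near the base point their chart expressions are unchanged. *)
Lemma near_component (Y : N -> 'rV[R]_n) p j :
  \forall u \near chart p p,
    local_rep id Y p u ord0 j
    = ((fun q => local_rep id Y p (chart p q) ord0 j) \o param p) u.
Proof.
by apply: filterS (near_chart_image (mem_dom p)) => u /paramK /= ->.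
Qed.

Lemma smooth_component (Y : N -> 'rV[R]_n) p j : smooth_field Y p ->
  smooth_fun (fun q => local_rep id Y p (chart p q) ord0 j) p.
Proof.
by move=> /(smooth_near_coord j); exact: eq_smooth_near (near_component Y p j).
Qed.

Lemma local_rep_base (k : nat) (M : manifold R k) (f : M -> N)
    (V : M -> 'rV[R]_n) (x : M) : local_rep f V x (chart x x) = V x.
Proof.
rewrite /local_rep (chartK (mem_dom x)).
by have [_ ->] := diff_chart_id (mem_dom (f x)).
Qed.

Lemma deriv_component (Y : N -> 'rV[R]_n) p j v : smooth_field Y p ->
  deriv_fun (fun q => local_rep id Y p (chart p q) ord0 j) p v
  = 'd (local_rep id Y p) (chart p p) v ord0 j.
Proof.
move=> /smooth_near_differentiable /nbhs_singleton dY.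
have dYj := is_diff_coord j (differentiableP dY).
by have [_ H] := near_eq_is_diff (near_component Y p j) dYj; rewrite /deriv_fun H.
Qed.

End Charts.

(** * Affine connections: locality and expansion in a coordinate frame *)

Section Connection.
Variables (R : realType) (n : nat) (N : manifold R n).
Variable nabla : N -> 'rV[R]_n -> (N -> 'rV[R]_n) -> 'rV[R]_n.
Hypothesis nablaP : affine_connection nabla.
Implicit Types (p q : N) (v : 'rV[R]_n) (X Y : N -> 'rV[R]_n).

Lemma connection_linear p Y : smooth_field Y p -> linear (nabla p ^~ Y).
Proof. by move=> Y_sm a u v; have [H _ _ _] := nablaP; exact: H. Qed.

Lemma connection_row p v Y : smooth_field Y p ->
  nabla p v Y = \sum_i v ord0 i *: nabla p (delta_mx ord0 i) Y.
Proof.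
move=> Y_sm.
pose lM := GRing.isLinear.Build _ _ _ _ _ (connection_linear Y_sm).
pose l : {linear 'rV[R]_n -> 'rV[R]_n} := HB.pack (nabla p ^~ Y) lM.
exact: (linear_row l).
Qed.

(* Apply the Leibniz rule to the indicator function of [X q = Y q]. *)
Lemma connection_local p v X Y :
  (\forall q \near p, X q = Y q) -> smooth_field X p ->
  nabla p v X = nabla p v Y.
Proof.
move=> XY X_sm; have Y_sm := eq_smooth_field XY X_sm.
pose h q : R := if pselect (X q = Y q) then 1 else 0.
have h1 : \forall u \near chart p p, 1 = (h \o param p) u.
  apply: filterS (near_param (mem_dom p) XY) => u XYu.
  by rewrite /h /=; case: pselect.
have h_sm : smooth_fun h p.
  exact: eq_smooth_near h1 (smooth_near_cst _ (1 : R)).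
have hp : h p = 1 by rewrite /h; case: pselect (nbhs_singleton XY).
have dh : deriv_fun h p v = 0.
  have [_ H] := near_eq_is_diff h1 (is_diff_cst (1 : R) (chart p p)).
  by rewrite /deriv_fun H.
have [_ _ leibniz _] := nablaP.
have nablaE Z : smooth_field Z p -> nabla p v (fun q => h q *: Z q) = nabla p v Z.
  by move=> Z_sm; rewrite leibniz// dh hp scale0r add0r scale1r.
(* The truncated fields coincide everywhere, not only near [p], so [nabla] takes the same value on
   them. *)
rewrite -(nablaE X X_sm) -(nablaE Y Y_sm); congr nabla.
apply/funext => q; rewrite /h.
by case: pselect => [XYq|_] /=; rewrite ?scale1r ?scale0r.
Qed.

Lemma connection0 p v : nabla p v (fun _ => 0) = 0.
Proof.
have [_ nablaD _ _] := nablaP.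
have s0 := smooth_field0 p.
have := nablaD p v _ _ s0 s0.
under eq_fun do rewrite addr0.
by move/eqP; rewrite -subr_eq0 opprD addrA subrr sub0r oppr_eq0 => /eqP.
Qed.

(** Smoothness of the partial sums is carried through the induction because additivity of [nabla] is
    only available for smooth fields. *)
Lemma connection_sum p v (I : Type) (s : seq I) (h : I -> N -> R)
    (E : I -> N -> 'rV[R]_n) :
  (forall i, smooth_fun (h i) p) -> (forall i, smooth_field (E i) p) ->
  smooth_field (fun q => \sum_(i <- s) h i q *: E i q) p /\
  nabla p v (fun q => \sum_(i <- s) h i q *: E i q)
  = \sum_(i <- s) (deriv_fun (h i) p v *: E i p + h i p *: nabla p v (E i)).
Proof.
move=> h_sm E_sm; have [_ nablaD leibniz _] := nablaP.
elim: s => [|i s [IHs IHn]].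
  under eq_fun do rewrite big_nil.
  by rewrite big_nil connection0; split=> //; exact: smooth_field0.
have hE := smooth_fieldZ (h_sm i) (E_sm i).
under eq_fun do rewrite big_cons.
by rewrite big_cons nablaD// leibniz// IHn; split=> //; exact: smooth_fieldD.
Qed.

(** By locality [Y] may be replaced by its expansion in the coordinate frame at [p], to which the
    Leibniz rule applies term by term. This is the formula of [cov_along] for the identity map. *)
Lemma connection_coord p v Y : smooth_field Y p ->
  nabla p v Y = 'd (local_rep id Y p) (chart p p) v
    + \sum_j Y p ord0 j *: nabla p v (coord_field p j).
Proof.
move=> Y_sm.
pose y j q := local_rep id Y p (chart p q) ord0 j.
have y_sm j : smooth_fun (y j) p by exact: smooth_component.
have Y_exp : \forall q \near p, Y q = \sum_j y j q *: coord_field p j q.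
  apply: filterS (near_dom (mem_dom p)) => q pq.
  rewrite [LHS](coord_field_expansion _ pq); apply: eq_bigr => j _.
  by rewrite /y /local_rep chartK.
rewrite (connection_local v Y_exp Y_sm).
have [_ ->] := connection_sum v (index_enum 'I_n) y_sm (smooth_field_coord p).
rewrite big_split /= [X in _ = X + _]row_sum_delta; congr (_ + _).
  by apply: eq_bigr => j _; rewrite coord_field_base deriv_component.
by apply: eq_bigr => j _; rewrite /y (local_rep_base id Y).
Qed.

End Connection.

(** * Fields along a map *)

Section FieldsAlongMap.
Variables (R : realType) (k n : nat) (M : manifold R k) (N : manifold R n).
Variable f : M -> N.
Hypothesis f_smooth : smooth_map f.
Implicit Types (x y : M) (W Z : M -> 'rV[R]_k) (V : M -> 'rV[R]_n).

Let rep x := chart (f x) \o f \o param x.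

Lemma near_map_dom x y :
  dom (f x) (f y) -> \forall z \near y, dom (f x) (f z).
Proof. by move=> xy; apply: f_smooth.1; exact: near_dom. Qed.

Lemma near_rep_differentiable x :
  \forall u \near chart x x, differentiable (rep x) u.
Proof. exact/smooth_near_differentiable/f_smooth.2. Qed.

Lemma rep_differentiable x : differentiable (rep x) (chart x x).
Proof. exact: nbhs_singleton (near_rep_differentiable x). Qed.

Lemma is_diff_codomain_change x y :
  dom (f x) (f y) ->
  is_diff (chart y y) (chart (f x) \o f \o param y)
    ('d (chart (f x) \o param (f y)) (chart (f y) (f y)) \o push f y).
Proof.
move=> xy.
have e : chart (f y) (f y) = rep y (chart y y).
  by rewrite /rep /= chartK//; exact: mem_dom.
have dtr := transition_differentiable (mem_dom (f y)) xy.
have dtr' : is_diff (rep y (chart y y)) (chart (f x) \o param (f y))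
    ('d (chart (f x) \o param (f y)) (chart (f y) (f y))).
  by rewrite -e; exact: differentiableP.
apply: near_eq_is_diff (is_diff_comp (differentiableP (rep_differentiable y)) dtr').
apply: filterS (near_param (mem_dom y) (near_map_dom (mem_dom (f y)))) => u yu.
by rewrite /rep /= chartK.
Qed.

(** Both sides are the differential of [chart (f x) \o f \o param y], computed by changing the chart
    in the target and in the source respectively. *)
Lemma push_transition x y w :
  dom x y -> dom (f x) (f y) -> differentiable (rep x) (chart x y) ->
  'd (chart (f x) \o param (f y)) (chart (f y) (f y)) (push f y w)
  = 'd (rep x) (chart x y) ('d (chart x \o param y) (chart y y) w).
Proof.
move=> xy fxy d.
have [_ H] := is_diff_codomain_change fxy.
have [_ H'] := diff_param_change (h := chart (f x) \o f) xy (mem_dom y) d.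
exact: (congr1 (fun F => F w) (etrans (esym H) H')).
Qed.

(** In the fixed charts at [x] and [f x] the pushed field is the Jacobian of [f] applied to the
    components of [W]; the charts that vary with the point disappear. *)
Lemma near_local_rep_push x W :
  \forall u \near chart x x,
    'd (rep x) u (local_rep id W x u)
    = local_rep f (fun y => push f y (W y)) x u.
Proof.
have dx := near_param (mem_dom x) (near_dom (mem_dom x)).
have dfx := near_param (mem_dom x) (near_map_dom (mem_dom (f x))).
apply: filterS3 (near_chart_image (mem_dom x)) dfx (near_rep_differentiable x)
  => u [y xy <-] fxy d.
rewrite chartK// in fxy.
by rewrite /local_rep chartK// push_transition.
Qed.

(** Product rule for the Jacobian applied to the components of [W], written column by column; the
    last sum is the Hessian of the local expression of [f] in the directions [W x] and [v]. *)
Lemma is_diff_local_rep_push x W : smooth_field W x ->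
  is_diff (chart x x) (local_rep f (fun y => push f y (W y)) x)
    (fun v => push f x ('d (local_rep id W x) (chart x x) v)
       + \sum_j W x ord0 j
           *: 'd (fun u => 'd (rep x) u (delta_mx ord0 j)) (chart x x) v).
Proof.
move=> W_sm; apply: near_eq_is_diff (near_local_rep_push x W) _.
rewrite (_ : (fun u => 'd (rep x) u (local_rep id W x u)) =
    fun u => \sum_j local_rep id W x u ord0 j
                      *: 'd (rep x) u (delta_mx ord0 j)); last first.
  by apply/funext => u; exact: linear_row.
have dW j := is_diff_coord j (differentiableP
  (nbhs_singleton (smooth_near_differentiable W_sm))).
have dF j := differentiableP (nbhs_singleton (smooth_near_differentiable
  (smooth_near_diff (delta_mx ord0 j) (f_smooth.2 x)))).
have := is_diff_sum (fun j => is_diff_scale (dW j) (dF j)).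
move=> /is_diff_eq; apply; apply/funext => v.
rewrite big_split /= addrC; congr (_ + _); first by rewrite [RHS]linear_row.
by apply: eq_bigr => j _; rewrite (local_rep_base id W).
Qed.

End FieldsAlongMap.

Lemma cov_alongN (R : realType) (k n : nat) (M : manifold R k)
    (N : manifold R n) (f : M -> N)
    (nabla : N -> 'rV[R]_n -> (N -> 'rV[R]_n) -> 'rV[R]_n)
    (V : M -> 'rV[R]_n) (x : M) (v : 'rV[R]_k) :
  differentiable (local_rep f V x) (chart x x) ->
  cov_along f nabla (fun y => - V y) x v = - cov_along f nabla V x v.
Proof.
move=> dV; rewrite /cov_along opprD -sumrN.
have -> : local_rep f (fun y => - V y) x = - local_rep f V x.
  by apply/funext => u; rewrite /local_rep [LHS]linearN.
apply: (f_equal2 +%R); first exact: (congr1 (fun F => F v) (diffN dV)).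
by apply: eq_bigr => j _; rewrite mxE scaleNr.
Qed.

(** * Covariant derivative along a map: torsion and parallel endomorphisms *)

Section CovariantDerivative.
Variables (R : realType) (k n : nat) (M : manifold R k) (N : manifold R n).
Variable f : M -> N.
Hypothesis f_smooth : smooth_map f.
Variable nabla : N -> 'rV[R]_n -> (N -> 'rV[R]_n) -> 'rV[R]_n.
Hypothesis nablaP : affine_connection nabla.
Implicit Types (x y : M) (W Z : M -> 'rV[R]_k) (V : M -> 'rV[R]_n).

Lemma cov_along_local x V V' v :
  (\forall y \near x, V y = V' y) ->
  differentiable (local_rep f V x) (chart x x) ->
  cov_along f nabla V x v = cov_along f nabla V' x v.
Proof.
move=> VV' dV; rewrite /cov_along.
have VVx : V x = V' x := nbhs_singleton VV'.
rewrite VVx; apply: (congr1 (fun z => z + _)).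
have e : \forall u \near chart x x, local_rep f V x u = local_rep f V' x u.
  apply: filterS (near_param (mem_dom x) VV') => u VVu.
  by rewrite /local_rep VVu.
exact: esym (congr1 (fun F => F v) (near_eq_diff e dV)).
Qed.

(** The derivative of a pushed field splits into the push of a chart derivative, a Hessian term and
    a Christoffel term. The last two are symmetric and cancel; the first gives the bracket. *)
Lemma cov_along_torsion (g : N -> 'M[R]_n) x Z W :
  levi_civita g nabla -> smooth_field Z x -> smooth_field W x ->
  cov_along f nabla (fun y => push f y (W y)) x (Z x)
  - cov_along f nabla (fun y => push f y (Z y)) x (W x)
  = push f x (lie_bracket Z W x).
Proof.
move=> [_ torsion _] Z_sm W_sm.
(* Coordinate fields have constant components in their own chart, so their bracket vanishes and the
   torsion condition becomes this symmetry. *)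
have christoffel_sym i j : nabla (f x) (delta_mx ord0 i) (coord_field (f x) j)
    = nabla (f x) (delta_mx ord0 j) (coord_field (f x) i).
  have := torsion (f x) _ _ (smooth_field_coord (f x) i)
    (smooth_field_coord (f x) j).
  have d0 (l : 'I_n) v :
      'd (local_rep id (coord_field (f x) l) (f x)) (chart (f x) (f x)) v = 0.
    have e : \forall u \near chart (f x) (f x),
        delta_mx ord0 l = local_rep id (coord_field (f x) l) (f x) u.
      by apply: filterS (near_local_rep_coord (f x) l) => u ->.
    have [_ H] := near_eq_is_diff e
      (is_diff_cst (delta_mx ord0 l : 'rV[R]_n) (chart (f x) (f x))).
    by rewrite H.
  have -> : lie_bracket (coord_field (f x) i) (coord_field (f x) j) (f x) = 0.
    rewrite /lie_bracket -[RHS](subr0 0).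
    by apply: (f_equal2 (fun a b => a - b)); exact: d0.
  by rewrite !coord_field_base => /eqP; rewrite subr_eq0 => /eqP.
pose C (z w : 'rV[R]_n) := \sum_j w ord0 j *: nabla (f x) z (coord_field (f x) j).
have C_sym z w : C z w = C w z.
  have CE z' w' : C z' w' = \sum_j \sum_i (w' ord0 j * z' ord0 i)
      *: nabla (f x) (delta_mx ord0 i) (coord_field (f x) j).
    apply: eq_bigr => j _.
    rewrite (connection_row nablaP z' (smooth_field_coord (f x) j)) scaler_sumr.
    by apply: eq_bigr => i _; rewrite scalerA.
  rewrite !CE exchange_big /=; apply: eq_bigr => i _; apply: eq_bigr => j _.
  by rewrite christoffel_sym mulrC.
pose F := chart (f x) \o f \o param x.
pose H (z w : 'rV[R]_k) := \sum_j w ord0 j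
  *: 'd (fun u => 'd F u (delta_mx ord0 j)) (chart x x) z.
have H_sym z w : H z w = H w z.
  have HE z' w' : H z' w' = \sum_j \sum_i (w' ord0 j * z' ord0 i)
      *: 'd (fun u => 'd F u (delta_mx ord0 j)) (chart x x) (delta_mx ord0 i).
    apply: eq_bigr => j _; rewrite [X in _ *: X]linear_row scaler_sumr.
    by apply: eq_bigr => i _; rewrite scalerA.
  rewrite !HE exchange_big /=; apply: eq_bigr => i _; apply: eq_bigr => j _.
  rewrite mulrC; apply: (congr1 (fun v => _ *: v)).
  exact: (smooth_near_diff_sym _ _ (f_smooth.2 x)).
have covE z W' : smooth_field W' x ->
    cov_along f nabla (fun y => push f y (W' y)) x z
    = push f x ('d (local_rep id W' x) (chart x x) z) + H z (W' x)
      + C (push f x z) (push f x (W' x)).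
  move=> W'_sm; rewrite /cov_along.
  by have [_ ->] := is_diff_local_rep_push f_smooth W'_sm.
rewrite !covE// H_sym C_sym -2!(addrA _ (H _ _)).
rewrite opprD addrACA subrr addr0 /lie_bracket.
by rewrite /push [RHS]linearB.
Qed.

Variable phi : N -> 'M[R]_n.
Hypothesis phi_smooth : forall p X, smooth_field X p ->
  smooth_field (fun q => app_endo phi q (X q)) p.
Hypothesis phi_parallel : forall p v Y, smooth_field Y p ->
  nabla p v (fun q => app_endo phi q (Y q)) = app_endo phi p (nabla p v Y).

Lemma app_endo_sum p (I : Type) (s : seq I) (c : I -> R) (w : I -> 'rV[R]_n) :
  app_endo phi p (\sum_(i <- s) c i *: w i)
  = \sum_(i <- s) c i *: app_endo phi p (w i).
Proof.
by rewrite /app_endo mulmx_suml; apply: eq_bigr => i _; rewrite scalemxAl.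
Qed.

(** [V] lives along [f], while [phi_parallel] concerns fields on [N]. Hence [phi V] is expanded in
    the ambient fields [phi_e j], restricted to [f], with the components of [V] as coefficients. The
    differentiability claim allows the lemma to be iterated. *)
Lemma cov_along_endo x V :
  differentiable (local_rep f V x) (chart x x) ->
  differentiable (local_rep f (fun y => app_endo phi (f y) (V y)) x) (chart x x)
  /\ forall v, cov_along f nabla (fun y => app_endo phi (f y) (V y)) x v
             = app_endo phi (f x) (cov_along f nabla V x v).
Proof.
move=> dV; set p := f x.
pose F := chart p \o f \o param x.
pose phi_e j q := app_endo phi q (coord_field p j q).
have phi_e_sm j : smooth_field (phi_e j) p.
  by apply: phi_smooth; exact: smooth_field_coord.
pose G j := local_rep id (phi_e j) p.
have Fp : F (chart x x) = chart p p by rewrite /F /= chartK//; exact: mem_dom.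
have dF : is_diff (chart x x) F (push f x).
  exact/differentiableP/rep_differentiable.
have dG j : is_diff (F (chart x x)) (G j) ('d (G j) (chart p p)).
  rewrite Fp; apply: differentiableP.
  exact: nbhs_singleton (smooth_near_differentiable (phi_e_sm j)).
have e : \forall u \near chart x x,
    \sum_j local_rep f V x u ord0 j *: (G j \o F) u
    = local_rep f (fun y => app_endo phi (f y) (V y)) x u.
  have near_fdom := near_map_dom f_smooth (mem_dom p).
  apply: filterS (near_param (mem_dom x) near_fdom) => u fu.
  rewrite /local_rep -/p [in RHS](coord_field_expansion (V (param x u)) fu).
  rewrite app_endo_sum linear_sum; apply: eq_bigr => j _.
  by rewrite linearZ /G /F /local_rep /= chartK.
have dVj j := is_diff_coord j (differentiableP dV).
have := is_diff_sum (fun j => is_diff_scale (dVj j) (is_diff_comp dF (dG j))).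
move=> /(near_eq_is_diff e) [d dE]; split=> // v.
rewrite {1}/cov_along dE /cov_along /=.
rewrite [RHS]/app_endo mulmxDl -!/(app_endo phi _ _) app_endo_sum.
have Gp j : G j (F (chart x x)) = app_endo phi p (delta_mx ord0 j).
  by rewrite Fp /G (local_rep_base id) /phi_e coord_field_base.
rewrite (local_rep_base f V) big_split /= -addrA addrC.
rewrite [X in _ = app_endo _ _ X + _]row_sum_delta app_endo_sum -addrA.
congr (_ + _); first by apply: eq_bigr => j _; rewrite Gp.
(* Parallelism is used here, on the coordinate fields: [phi] moves inside [nabla], and the resulting
   field is expanded in coordinates. *)
have nabla_e j : app_endo phi p (nabla p (push f x v) (coord_field p j)) =
    'd (G j) (chart p p) (push f x v)
    + \sum_i app_endo phi p (delta_mx ord0 j) ord0 i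
         *: nabla p (push f x v) (coord_field p i).
  rewrite -phi_parallel; last exact: smooth_field_coord.
  rewrite (connection_coord nablaP _ (phi_e_sm j)).
  by rewrite {2}/phi_e coord_field_base.
under [RHS]eq_bigr do rewrite nabla_e scalerDr scaler_sumr.
rewrite big_split /= addrC; congr (_ + _).
(* After the exchange, the inner sum over [j] is the [i]-th component of [phi] applied to [V x]. *)
rewrite exchange_big /=; apply: eq_bigr => i _.
rewrite {1}[V x]row_sum_delta app_endo_sum summxE scaler_suml.
by apply: eq_bigr => j _; rewrite mxE scalerA.
Qed.

End CovariantDerivative.

(** * Pointwise algebra *)

Section Inner.
Variables (R : realType) (n : nat) (N : manifold R n) (g : N -> 'M[R]_n).
Implicit Types (p : N) (u v w : 'rV[R]_n).

Lemma innerDl p u v w : inner g p (u + v) w = inner g p u w + inner g p v w.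
Proof. by rewrite /inner !mulmxDl mxE. Qed.

Lemma innerZl p (a : R) u w : inner g p (a *: u) w = a * inner g p u w.
Proof. by rewrite /inner -!scalemxAl mxE. Qed.

Lemma innerNl p u w : inner g p (- u) w = - inner g p u w.
Proof. by rewrite -scaleN1r innerZl mulN1r. Qed.

Lemma inner0l p w : inner g p 0 w = 0.
Proof. by rewrite /inner !mul0mx mxE. Qed.

Lemma inner0r p w : inner g p w 0 = 0.
Proof. by rewrite /inner trmx0 mulmx0 mxE. Qed.

End Inner.

Section Projection.
Variables (R : realType) (k n : nat) (M : manifold R k) (N : manifold R n).
Variables (g : N -> 'M[R]_n) (f : M -> N) (x : M).
Hypothesis g_pos : forall p u, u != 0 -> 0 < inner g p u u.
Hypothesis push_inj : injective (push f x).
Implicit Types (w : 'rV[R]_n) (u : 'rV[R]_k).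

Let pushD u v : push f x (u + v) = push f x u + push f x v.
Proof. exact: linearD. Qed.

Let pushB u v : push f x (u - v) = push f x u - push f x v.
Proof. exact: linearB. Qed.

Let push0 : push f x 0 = 0.
Proof. exact: linear0. Qed.

Lemma is_normalB w1 w2 :
  is_normal g f x w1 -> is_normal g f x w2 -> is_normal g f x (w1 - w2).
Proof. by move=> n1 n2 u; rewrite innerDl innerNl n1 n2 subr0. Qed.

(* The projection is obtained by inverting the Gram matrix of the coordinate
   basis of T_xM. *)
Lemma tan_partP w : is_normal g f x (w - push f x (tan_part g f x w)).
Proof.
suff [u Hu] : exists u, is_normal g f x (w - push f x u).
  exact: (@xgetPex _ 0 [set u | is_normal g f x (w - push f x u)]
    (ex_intro _ u Hu)).
pose P := lin1_mx (push f x).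
have PE u : push f x u = u *m P.
  by rewrite /P /push mul_rV_lin1.
pose G := P *m g (f x) *m P^T.
have G_unit : G \in unitmx.
  (* A vector killed by the Gram matrix has an image of zero length, hence vanishes by positivity of
     [g] and injectivity of [push f x]. *)
  rewrite -row_free_unit; apply: inj_row_free => v vG.
  apply: push_inj; rewrite push0; apply/eqP; apply: contraT => /(g_pos (f x)).
  rewrite /inner PE trmx_mul !mulmxA -(mulmxA v P) -(mulmxA v) -/G.
  by rewrite vG mul0mx mxE ltxx.
exists (w *m g (f x) *m P^T *m invmx G) => v.
rewrite innerDl innerNl /inner !PE trmx_mul !mulmxA.
set X := w *m _ *m P^T.
have -> : X *m invmx G *m P *m g (f x) *m P^T = X.
  by rewrite -!mulmxA (mulmxA P) -/G mulVmx// mulmx1 /X ?mulmxA.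
by rewrite subrr.
Qed.

(** The difference of two candidates is pushed to a vector both tangent and normal, so of zero
    length. *)
Lemma tan_part_unique w u :
  is_normal g f x (w - push f x u) -> tan_part g f x w = u.
Proof.
move=> nu; apply: push_inj; apply/eqP; rewrite -subr_eq0.
apply: contraT => /(g_pos (f x)).
have := is_normalB nu (tan_partP w).
rewrite opprB addrC addrA subrK -pushB => nd.
by rewrite nd ltxx.
Qed.

Lemma tan_part_eq0 w : tan_part g f x w = 0 <-> is_normal g f x w.
Proof.
split=> [w0|nw]; first by have := tan_partP w; rewrite w0 push0 subr0.
by apply: tan_part_unique; rewrite push0 subr0.
Qed.

Lemma tan_partB w1 w2 :
  tan_part g f x (w1 - w2) = tan_part g f x w1 - tan_part g f x w2.
Proof.
apply: tan_part_unique.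
have := is_normalB (tan_partP w1) (tan_partP w2).
by rewrite pushB !opprB addrACA [- push f x _ - w2]addrC -addrACA.
Qed.

Lemma nor_part_normal w : is_normal g f x w -> nor_part g f x w = w.
Proof. by move=> /tan_part_eq0 w0; rewrite /nor_part w0 push0 subr0. Qed.

End Projection.

(** * Algebra of the almost contact structure *)

Section AlmostContact.
Variables (R : realType) (n : nat) (N : manifold R n).
Variables (phi : N -> 'M[R]_n) (xi : N -> 'rV[R]_n) (eta : N -> 'cV[R]_n).
Variable g : N -> 'M[R]_n.
Hypothesis contact : almost_contact_metric phi xi eta g.
Implicit Types (p : N) (u v : 'rV[R]_n).

Lemma app_endoD p u v :
  app_endo phi p (u + v) = app_endo phi p u + app_endo phi p v.
Proof. exact: mulmxDl. Qed.

Lemma app_endoB p u v :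
  app_endo phi p (u - v) = app_endo phi p u - app_endo phi p v.
Proof. exact: mulmxBl. Qed.

Lemma app_endoZ p (a : R) u : app_endo phi p (a *: u) = a *: app_endo phi p u.
Proof. by rewrite /app_endo scalemxAl. Qed.

Lemma app_formB p u v :
  app_form eta p (u - v) = app_form eta p u - app_form eta p v.
Proof. by rewrite /app_form mulmxBl !mxE. Qed.

Lemma reeb_neq0 p : xi p != 0.
Proof.
have [_ _ _ eta_xi _] := contact.
apply/eqP => xi0; have := eta_xi p; rewrite xi0 /app_form mul0mx mxE => /eqP.
by rewrite eq_sym oner_eq0.
Qed.

(** From [phi^2 xi = 0], the identity for [phi^2] at [phi xi] gives [phi xi = a xi] with
    [a = eta (phi xi)]. Applying [phi] again yields [a^2 xi = 0], and [xi] is nonzero. *)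
Lemma app_endo_reeb p : app_endo phi p (xi p) = 0.
Proof.
have [_ _ phi2 eta_xi _] := contact.
have phi2xi : app_endo phi p (app_endo phi p (xi p)) = 0.
  by rewrite phi2 eta_xi scale1r addNr.
have := phi2 p (app_endo phi p (xi p)).
rewrite phi2xi {1}/app_endo mul0mx; set a := app_form eta p _ => /esym/eqP.
rewrite addrC subr_eq0 eq_sym => /eqP phi_xi.
move: phi2xi; rewrite phi_xi app_endoZ phi_xi scalerA => /eqP.
rewrite scaler_eq0 (negPf (reeb_neq0 p)) orbF mulf_eq0 orbb => /eqP ->.
by rewrite scale0r.
Qed.

(** Compatibility of the metric with [phi], evaluated at [v = xi]. *)
Lemma app_form_inner p u : app_form eta p u = inner g p u (xi p).
Proof.
have [_ _ _ eta_xi compat] := contact.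
have := compat p u (xi p); rewrite app_endo_reeb inner0r eta_xi mulr1 => /esym/eqP.
by rewrite subr_eq0 => /eqP.
Qed.

End AlmostContact.

(** * Totally real distributions *)

Section TotallyReal.
Variables (R : realType) (k n : nat) (M : manifold R k) (N : manifold R n).
Variables (phi : N -> 'M[R]_n) (xi : N -> 'rV[R]_n) (eta : N -> 'cV[R]_n).
Variable g : N -> 'M[R]_n.
Variable nabla : N -> 'rV[R]_n -> (N -> 'rV[R]_n) -> 'rV[R]_n.
Variables (f : M -> N) (D : M -> {vspace 'rV[R]_k}).
Hypothesis N_cosymplectic : cosymplectic phi xi eta g nabla.
Hypothesis f_immersion : immersion f.
Hypothesis D_real : forall x v, v \in D x ->
  is_normal g f x (app_endo phi (f x) (push f x v)).
Hypothesis D_reeb : forall x v, v \in D x ->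
  inner g (f x) (push f x v) (xi (f x)) = 0.
Implicit Types (x : M) (Z W : M -> 'rV[R]_k).

Let g_pos : forall p u, u != 0 -> 0 < inner g p u u.
Proof. by have [[[]]] := N_cosymplectic. Qed.

Let contact : almost_contact_metric phi xi eta g.
Proof. by have [] := N_cosymplectic. Qed.

Let nablaP : affine_connection nabla.
Proof. by have [_ _ []] := N_cosymplectic. Qed.

Let phi_smooth p X : smooth_field X p ->
  smooth_field (fun q => app_endo phi q (X q)) p.
Proof. by have [_ [+ _ _] _ _ _] := contact; exact. Qed.

Let phi_parallel p v Y : smooth_field Y p ->
  nabla p v (fun q => app_endo phi q (Y q)) = app_endo phi p (nabla p v Y).
Proof.
move=> Y_sm; have [_ _ _ H _] := N_cosymplectic.
by apply/eqP; rewrite -subr_eq0 H.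
Qed.

Let f_smooth : smooth_map f := f_immersion.1.

Let diff_push x Z : smooth_field Z x ->
  differentiable (local_rep f (fun y => push f y (Z y)) x) (chart x x).
Proof. by move=> /(is_diff_local_rep_push f_smooth) []. Qed.

Lemma eta_cov_along x Z v : section_at D Z x ->
  app_form eta (f x) (cov_along f nabla (fun y => push f y (Z y)) x v) = 0.
Proof.
move=> [Z_sm ZD]; set V := fun y => push f y (Z y).
have [_ _ phi2 _ _] := contact.
have dV : differentiable (local_rep f V x) (chart x x) by exact: diff_push.
have [dphiV covphi] :=
  cov_along_endo f_smooth nablaP phi_smooth phi_parallel dV.
have [dphi2V covphi2] :=
  cov_along_endo f_smooth nablaP phi_smooth phi_parallel dphiV.
have phi2V : \forall y \near x,
    app_endo phi (f y) (app_endo phi (f y) (V y)) = - V y.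
  apply: filterS ZD => y Zy.
  by rewrite phi2 (app_form_inner contact) (D_reeb Zy) scale0r addr0.
(* The derivative of [phi^2 V = - V] is computed in two ways: as minus the derivative of [V], and as
   [phi^2] of it. The difference is its [eta] value times [xi]. *)
have := covphi2 v; rewrite (cov_along_local _ _ phi2V dphi2V) (cov_alongN _ _ dV).
rewrite covphi phi2 -[LHS]addr0 => /addrI/esym/eqP.
by rewrite scaler_eq0 (negPf (reeb_neq0 contact _)) orbF => /eqP.
Qed.

(** Along a section of [D] the field [phi V] is already normal, so it agrees with [FZ] near [x], and
    parallelism moves [phi] out of the derivative. *)
Lemma shape_operator_F_part x Z v : section_at D Z x ->
  shape_operator g nabla f (fun y => F_part phi g f y (Z y)) x v
  = - tan_part g f x (app_endo phi (f x)
        (cov_along f nabla (fun y => push f y (Z y)) x v)).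
Proof.
move=> [Z_sm ZD]; rewrite /shape_operator; congr (- tan_part _ _ _ _).
have [dphiV <-] :=
  cov_along_endo f_smooth nablaP phi_smooth phi_parallel (diff_push Z_sm).
apply/esym/cov_along_local => //; apply: filterS ZD => y Zy.
by rewrite /F_part nor_part_normal//; [exact: f_immersion.2|exact: D_real].
Qed.

(** By the previous formula the left side is the tangential part of [phi] applied to a difference of
    covariant derivatives, which torsion-freeness identifies with the bracket. *)
Lemma shape_operator_bracket x Z W : section_at D Z x -> section_at D W x ->
  shape_operator g nabla f (fun y => F_part phi g f y (Z y)) x (W x)
  - shape_operator g nabla f (fun y => F_part phi g f y (W y)) x (Z x)
  = tan_part g f x (app_endo phi (f x) (push f x (lie_bracket Z W x))).
Proof.
move=> ZD WD; rewrite !shape_operator_F_part//.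
have [_ _ levi _ _] := N_cosymplectic.
rewrite -(cov_along_torsion f_smooth nablaP levi ZD.1 WD.1) app_endoB.
by rewrite (tan_partB g_pos (f_immersion.2 x)) opprK addrC.
Qed.

(** Since [phi xi = 0], the shape operator identity cannot detect the [xi] component of the bracket;
    this lemma controls it. *)
Lemma bracket_orthogonal_reeb x Z W : section_at D Z x -> section_at D W x ->
  inner g (f x) (push f x (lie_bracket Z W x)) (xi (f x)) = 0.
Proof.
move=> ZD WD; have [_ _ levi _ _] := N_cosymplectic.
rewrite -(cov_along_torsion f_smooth nablaP levi ZD.1 WD.1).
by rewrite -(app_form_inner contact) app_formB !eta_cov_along// subrr.
Qed.

End TotallyReal.

(** * Integrability of the totally real distribution and symmetry of the shape operators *)

Theorem theorem3p5 (R : realType) (m k : nat)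
    (N : manifold R m.*2.+1)
    (phi : N -> 'M[R]_(m.*2.+1)) (xi : N -> 'rV[R]_(m.*2.+1))
    (eta : N -> 'cV[R]_(m.*2.+1)) (g : N -> 'M[R]_(m.*2.+1))
    (nabla : N -> 'rV[R]_(m.*2.+1) -> (N -> 'rV[R]_(m.*2.+1)) ->
             'rV[R]_(m.*2.+1))
    (M : manifold R k) (f : M -> N) (theta : R)
    (Dslant Dperp : M -> {vspace 'rV[R]_k}) :
  cosymplectic phi xi eta g nabla ->
  immersion f ->
  hemi_slant phi xi g f theta Dslant Dperp ->
  (integrable_distribution Dperp <->
   forall (x : M) (Z W : M -> 'rV[R]_k),
     section_at Dperp Z x -> section_at Dperp W x ->
     shape_operator g nabla f (fun y => F_part phi g f y (Z y)) x (W x)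
     = shape_operator g nabla f (fun y => F_part phi g f y (W y)) x (Z x)).
Proof.
move=> cosympl imm [reeb_tan _ split_TM [_ theta_neq slant] real_perp].
have contact : almost_contact_metric phi xi eta g by have [] := cosympl.
have g_pos : forall p u, u != 0 -> 0 < inner g p u u by have [[]] := contact.
have reeb_perp x v : v \in Dperp x -> inner g (f x) (push f x v) (xi (f x)) = 0.
  move=> vD; have [_ _ + _] := split_TM x => /(_ v vD).
  by rewrite /induced_inner reeb_tan.
have A_bracket := shape_operator_bracket cosympl imm real_perp.
have bracket_reeb := bracket_orthogonal_reeb cosympl imm reeb_perp.
split=> [integ x Z W ZD WD|A_sym x Z W ZD WD].
  (* If the bracket lies in [Dperp], then [phi] sends it to a normal vector, whose tangential part
     is zero. *)
  apply/eqP; rewrite -subr_eq0 A_bracket//; apply/eqP.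
  apply/(tan_part_eq0 g_pos (imm.2 x)); apply: real_perp.
  exact: integ.
have [_ _ _ TM_eq] := split_TM x.
have := memvf (lie_bracket Z W x); rewrite -TM_eq.
(* The bracket is split as [u + v + c xi] with [u] slant and [v] in [Dperp]; it remains to show
   [u = 0] and [c = 0]. *)
move=> /memv_addP[w /memv_addP[u uD [v vD ->]]] [_ /vlineP[c ->]] bracketE.
have pushE : push f x (lie_bracket Z W x)
    = push f x u + push f x v + c *: xi (f x).
  by rewrite bracketE -[in RHS](reeb_tan x) /push !linearD linearZ.
have /(tan_part_eq0 g_pos (imm.2 x)) : tan_part g f x
    (app_endo phi (f x) (push f x (lie_bracket Z W x))) = 0.
  by rewrite -A_bracket// A_sym// subrr.
rewrite pushE !app_endoD app_endoZ (app_endo_reeb contact) scaler0 addr0.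
(* Subtracting the normal vector [phi v] leaves [phi u] normal, that is [Tu = 0]. *)
move=> /is_normalB /(_ (real_perp x v vD)); rewrite addrK.
move=> /(tan_part_eq0 g_pos (imm.2 x)) Tu.
have u0 : u = 0.
  (* For nonzero [u] with [Tu = 0] the cosine of the slant angle is 0, so [theta] would be
     [pi / 2]. *)
  apply/eqP; apply: contraT => /(slant x u uD) angle.
  move: theta_neq; rewrite -angle /angle_with_tangent Tu /induced_inner.
  by rewrite /push linear0 inner0l sqrtr0 mul0r acos0 eqxx.
have c0 : c = 0.
  (* Pairing with [xi] kills the [Dperp] component and leaves [c] times the positive squared length
     of [xi]. *)
  have := bracket_reeb x Z W ZD WD.
  rewrite pushE u0 !innerDl (reeb_perp _ _ vD) /push linear0 inner0l !add0r.
  have reeb_pos : 0 < inner g (f x) (xi (f x)) (xi (f x)).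
    by apply: g_pos; exact: reeb_neq0 contact _.
  by rewrite innerZl => /eqP; rewrite mulf_eq0 (gt_eqF reeb_pos) orbF => /eqP.
by rewrite bracketE u0 c0 scale0r addr0 add0r.
Qed.
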